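(* Let $n\ge 1$, let $\Omega\subset\mathbb{R}^n$ be a domain containing the origin $0$, and let $F\in C^1(\Omega\times\mathbb{R}\times\mathbb{R}^n\times\mathcal{S}^{n\times n})$ satisfy the ellipticity condition that the matrix $\left(-\frac{\partial F}{\partial M_{ij}}(x,s,p,M)\right)$ is positive definite for all $(x,s,p,M)\in\Omega\times\mathbb{R}\times\mathbb{R}^n\times\mathcal{S}^{n\times n}$. Let $u\in C^2(\Omega\setminus\{0\})$ and $v\in C^2(\Omega)$. Assume that for some $\bar r>0$ with $B_{\bar r}\subset\Omega$ the following holds: for every $V\in\mathbb{R}^n$, the function $w(x):=u(x)+V\cdot x$ satisfies $$\inf_{B_r\setminus\{0\}}w=\min_{\partial B_r}w\qquad\text{for all } 0<r<\bar r.$$ Assume also that $u>v$ in $\Omega\setminus\{0\}$ and $$F(x,u,\nabla u,\nabla^2u)\ge F(x,v,\nabla v,\nabla^2 v)\qquad\text{in }\Omega\setminus\{0\}.$$ Then $$\liminf_{|x|\to0}(u-v)(x)>0.$$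
   Context: A domain is a bounded connected open set. $\mathcal{S}^{n\times n}$ is the set of real symmetric $n\times n$ matrices. $B_r$ is the open ball of radius $r$ centered at the origin of $\mathbb{R}^n$. *)

(* Defs.v *)
From HB Require Import structures.
From mathcomp Require Import all_boot all_order all_algebra.
From mathcomp Require Import all_classical all_reals all_analysis.

Set Implicit Arguments.
Unset Strict Implicit.
Unset Printing Implicit Defensive.

Import Order.TTheory GRing.Theory Num.Theory.
Import numFieldNormedType.Exports.

Local Open Scope classical_set_scope.
Local Open Scope ring_scope.

Definition dot (R : realType) (n : nat) (x y : 'rV[R]_n) : R :=
  \sum_i x 0 i * y 0 i.

(* The norm `|x| provided on 'rV[R]_n is the sup norm; it induces the same
   topology and the same bounded sets, but not the same balls. *)
Definition enorm (R : realType) (n : nat) (x : 'rV[R]_n) : R :=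
  Num.sqrt (dot x x).

Definition eball (R : realType) (n : nat) (r : R) : set 'rV[R]_n :=
  [set x | enorm x < r].

Definition boundary (T : topologicalType) (A : set T) : set T :=
  closure A `\` interior A.

Definition is_domain (R : realType) (n : nat) (D : set 'rV[R]_n) : Prop :=
  [/\ open D, connected D & bounded_set D].

Definition is_min (R : realType) (A : set R) (m : R) : Prop :=
  A m /\ lbound A m.

(* C^1 regularity on D of a real function, where D is relatively open in a
   linear subspace T of U: only the values of f on D and the directions in T
   matter, so that T = setT gives the usual notion on an open set D. *)
Definition C1_along (R : realType) (U : normedModType R) (T D : set U)
    (f : U -> R) : Prop :=
  {within D, continuous f} /\
  forall v, T v ->
    (forall z, D z -> derivable f z v) /\ {within D, continuous ('D_v f)}.

Definition C2 (R : realType) (n : nat) (D : set 'rV[R]_n)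
    (f : 'rV[R]_n -> R) : Prop :=
  C1_along setT D f /\ forall v, C1_along setT D ('D_v f).

Definition grad (R : realType) (n : nat) (f : 'rV[R]_n -> R)
    (x : 'rV[R]_n) : 'rV[R]_n :=
  \row_i 'D_(delta_mx 0 i) f x.

Definition hessian (R : realType) (n : nat) (f : 'rV[R]_n -> R)
    (x : 'rV[R]_n) : 'M[R]_n :=
  \matrix_(i, j) 'D_(delta_mx 0 j) ('D_(delta_mx 0 i) f) x.

(* Points (x, s, p, M). An operator F is a function on all of jet R n, of which
   only the values at symmetric M are ever used. *)
Definition jet (R : realType) (n : nat) : normedModType R :=
  ('rV[R]_n * R * 'rV[R]_n * 'M[R]_n)%type.

Definition jet_dom (R : realType) (n : nat) (D : set 'rV[R]_n) :
    set (jet R n) :=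
  [set z | D z.1.1.1 /\ z.2 \is symmetricmx].

Definition C1_operator (R : realType) (n : nat) (D : set 'rV[R]_n)
    (F : jet R n -> R) : Prop :=
  C1_along (jet_dom setT) (jet_dom D) F.

(* The matrix (dF/dM_ij): F lives on symmetric matrices, so the (i, j) entry is
   the derivative along (E_ij + E_ji) / 2. These are the entries of the
   symmetric matrix A such that the differential of F in the variable M is
   N |-> \sum_ij A_ij N_ij on symmetric N. *)
Definition dF_dM (R : realType) (n : nat) (F : jet R n -> R)
    (z : jet R n) : 'M[R]_n :=
  \matrix_(i, j)
    'D_((0, 0, 0, 2^-1 *: (delta_mx i j + delta_mx j i)) : jet R n) F z.

Definition posdefmx (R : realType) (n : nat) (A : 'M[R]_n) : Prop :=
  A \is symmetricmx /\
  forall xi : 'rV[R]_n, xi != 0 -> 0 < (xi *m A *m xi^T) 0 0.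

(* Main.v *)
Require Import Defs.
From mathcomp Require Import all_boot all_order all_algebra.
From mathcomp Require Import all_classical all_reals all_analysis.
From mathcomp Require Import ring lra.

Set Implicit Arguments.
Unset Strict Implicit.
Unset Printing Implicit Defensive.

Import Order.TTheory GRing.Theory Num.Theory.
Import numFieldNormedType.Exports.

Local Open Scope classical_set_scope.
Local Open Scope ring_scope.

(* A direct use of the minimum principle with V = - grad v(0) needs a linear gap
   between u and v.  It comes from the barriers h(x) = V . x + A |x|^2, |V| <= 1:
   since h(0) = 0, a negative minimum of u - v - eps h over 0 < |x| <= r is
   interior and nonzero, and there u has the jet of v perturbed by
   eps (0, sigma, V + 2 A x, 2 A I + N) with sigma bounded and N psd; for A large,
   ellipticity makes F strictly smaller at u than at v, a contradiction.  Hence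
   u - v >= eps h, and taking V = (sg x_i) gives u - v >= eps |x|.  Then
   w = u - grad v(0) . x exceeds v(0) on a small sphere, so its minimum m there
   satisfies m > v(0), and the hypothesis propagates w >= m down to 0. *)

(** The obstacle is that nothing bounds [u] or its derivatives near 0, so [F] cannot be linearised
    between the jets of [u] and [v]. At a touching point, however, the gradient difference is
    prescribed, the value difference is pinched between 0 and [eps * h], and the Hessian is free in
    one direction only. Its psd excess [N] may be arbitrarily large; it is discarded by monotonicity
    of [F] along psd matrices, which uses ellipticity at every symmetric matrix. What remains is a
    perturbation of order [eps] of the jet of [v], close to the jet of [v] at 0, where continuity of
    the derivatives of [F] gives uniform constants. The bounds on [sigma] and on [V + 2 A x] do not
    involve [A] as long as [A |x| <= 1], so [A] can be fixed before the radius and [eps]. All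
    constants are uniform in [V], which allows the sign vector to vary with [x]. Regularity is given
    as continuity of directional derivatives; linearity in the direction and symmetry of second
    derivatives are recovered from the mean value theorem on lines. *)

(** * Derivatives along a line: mean value theorem and minimum conditions *)

Section directional_calculus.
Variables (R : realType) (U : normedModType R).
Implicit Types (f g : U -> R) (x z a b w : U) (t l : R).

Lemma is_derive_line f z a t l :
  is_derive (z + t *: a) a f l -> is_derive t 1 (fun s => f (z + s *: a)) l.
Proof.
have E : (fun h : R => h^-1 *: (((fun s => f (z + s *: a)) \o shift t) (h *: 1)
            - f (z + t *: a)))
       = (fun h : R => h^-1 *: ((f \o shift (z + t *: a)) (h *: a)
            - f (z + t *: a))).
  apply/funext => h /=; congr (_ *: (f _ - _)).
  rewrite [h *: 1]mulr1 scalerDl. by rewrite addrCA.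
by case=> df <-; apply: DeriveDef; rewrite ?/derivable ?/derive E.
Qed.

Lemma is_derive_shift f z a w l :
  is_derive (z + w) a f l -> is_derive z a (fun x => f (x + w)) l.
Proof.
have E : (fun h : R => h^-1 *: (((fun x => f (x + w)) \o shift z) (h *: a)
            - f (z + w)))
       = (fun h : R => h^-1 *: ((f \o shift (z + w)) (h *: a) - f (z + w))).
  by apply/funext => h /=; rewrite addrA.
by case=> df <-; apply: DeriveDef; rewrite ?/derivable ?/derive E.
Qed.

(** The one-variable theorem for the restriction to the line. Both signs of [t] occur in
    [derive_linear], where [t] is [h * c]; strict positivity of [s] is what [is_derive_min] needs to
    divide by the intermediate parameter. *)
Lemma MVT_line f (df : U -> R) z a t :
  (forall s, 0 <= s <= 1 ->
     is_derive (z + (s * t) *: a) a f (df (z + (s * t) *: a))) ->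
  exists2 s, 0 < s <= 1 &
    f (z + t *: a) - f z = t * df (z + (s * t) *: a).
Proof.
move=> fP; pose F s := f (z + s *: a); pose dF s := df (z + s *: a).
have [->|t0] := eqVneq t 0.
  by exists 1; rewrite ?lexx ?ltr01// scale0r addr0 subrr mul0r.
have dFP s : 0 <= s / t <= 1 -> is_derive s 1 F (dF s).
  by move=> /fP; rewrite divfK// => /is_derive_line.
have cont (x y : R) : (forall s, s \in `[x, y]%R -> is_derive s 1 F (dF s)) ->
    {within `[x, y], continuous F}.
  move=> H; apply: derivable_within_continuous => s /H.
  by case.
have [tp|tn|/esym/eqP] := ltgtP 0 t; last by rewrite (negPf t0).
- have H s : s \in `[0, t]%R -> is_derive s 1 F (dF s).
    rewrite in_itv/= => /andP[s0 st]; apply: dFP.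
    by rewrite divr_ge0 ?(ltW tp)//= ler_pdivrMr// mul1r.
  have Fc : {within `[0, t], continuous F} by exact: cont H.
  have Ho s : s \in `]0, t[%R -> is_derive s 1 F (dF s).
    by move=> /subset_itv_oo_cc; exact: H.
  have [c] := MVT tp Ho Fc.
  rewrite in_itv/= /F/dF subr0 scale0r addr0 mulrC => /andP[c0 ct] ->.
  exists (c / t); last by rewrite divfK.
  by rewrite divr_gt0//= ler_pdivrMr// mul1r ltW.
- have H s : s \in `[t, 0]%R -> is_derive s 1 F (dF s).
    rewrite in_itv/= => /andP[s0 st]; apply: dFP.
    by rewrite ler_ndivrMr// mul1r s0 andbT -mulrNN -invrN divr_ge0// oppr_ge0// ltW.
  have Fc : {within `[t, 0], continuous F} by exact: cont H.
  have Ho s : s \in `]t, 0[%R -> is_derive s 1 F (dF s).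
    by move=> /subset_itv_oo_cc; exact: H.
  have [c] := MVT tn Ho Fc.
  rewrite in_itv/= /F/dF sub0r scale0r addr0 => /andP[c0 ct] E.
  exists (c / t); last by rewrite divfK// -opprB E mulrN opprK mulrC.
  by rewrite ler_ndivrMr// mul1r (ltW c0) andbT -mulrNN -invrN divr_gt0// oppr_gt0.
Qed.

Lemma is_derive_quotient f z a l : is_derive z a f l ->
  forall e, 0 < e -> exists2 d, 0 < d &
    forall h, `|h| < d -> h != 0 -> `|h^-1 * (f (z + h *: a) - f z) - l| < e.
Proof.
case=> df <- e e0; move/cvgrPdist_lt: df => /(_ e e0).
move=> /nbhs_ballP[d /= d0 H]; exists d => // h hd h0.
rewrite distrC; have := H h; rewrite /ball/= sub0r normrN => /(_ hd h0).
by rewrite [_ + z]addrC.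
Qed.

Lemma is_derive_of_quotient f z a l :
  (forall e, 0 < e -> exists2 d, 0 < d &
    forall h, `|h| < d -> h != 0 -> `|h^-1 * (f (z + h *: a) - f z) - l| <= e) ->
  is_derive z a f l.
Proof.
move=> H.
have C : h^-1 *: ((f \o shift z) (h *: a) - f z) @[h --> 0^'] --> l.
  apply/cvgrPdist_le => e e0; have [d d0 K] := H e e0.
  apply/nbhs_ballP; exists d => // h; rewrite /ball/= sub0r normrN => hd h0.
  by rewrite distrC [_ + z]addrC; exact: K.
by apply: DeriveDef; [apply/cvg_ex; exists l|exact: cvg_lim C].
Qed.

(** Since increments of [f] are nonnegative, a nonzero slope would force [s * f1 x] to be positive
    for small [s] of either sign. A negative [l] would make [f1] negative just after [x], and [f]
    would decrease there by the mean value theorem. *)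
Lemma is_derive_min f (f1 : U -> R) x a l d : 0 < d ->
  (forall t, `|t| < d -> f x <= f (x + t *: a)) ->
  (forall t, `|t| < d -> is_derive (x + t *: a) a f (f1 (x + t *: a))) ->
  is_derive x a f1 l -> f1 x = 0 /\ 0 <= l.
Proof.
move=> d0 fmin ff1 f1l.
have fx : is_derive x a f (f1 x).
  by have := ff1 0; rewrite normr0 scale0r addr0; apply.
have f10 : f1 x = 0.
  apply/eqP; apply/negPn/negP => n0.
  have n0' : 0 < `|f1 x| by rewrite normr_gt0.
  have [e e0 H] := is_derive_quotient fx n0'.
  pose r := Num.min d e / 2.
  have r0 : 0 < r by rewrite divr_gt0// lt_min d0.
  have rlt : r < Num.min d e by rewrite ltr_pdivrMr// mulr_natr mulr2n ltrDl lt_min d0.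
  move: rlt; rewrite lt_min => /andP[rd re].
  have sgn s : `|s| = r -> s != 0 -> 0 < s * f1 x.
    move=> sr s0.
    have := H s; rewrite sr => /(_ re s0).
    have := fmin s; rewrite sr => /(_ rd); rewrite -subr_ge0.
    set q := f _ - _ => q0; rewrite -(ltr_pM2l r0) -{1}sr -normrM mulrBr mulVKf//.
    have [s1|s1] := ltP 0 s.
      rewrite (gtr0_norm s1) in sr; rewrite {}sr.
      have [y0|y0] := ltP 0 (f1 x); first by move=> _; exact: mulr_gt0.
      rewrite (ler0_norm y0) ger0_norm; first by lra.
      by rewrite subr_ge0 (le_trans _ q0)// mulr_ge0_le0// ltW.
    rewrite (ler0_norm s1) in sr.
    have [y0|y0] := ltP (f1 x) 0.
      move=> _. by rewrite -mulrNN mulr_gt0// ?sr// oppr_gt0.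
    rewrite (ger0_norm y0) ger0_norm; first by rewrite -sr; lra.
    by rewrite subr_ge0 (le_trans _ q0)// mulr_le0_ge0// ltW.
  have := sgn r; have := sgn (- r); rewrite normrN gtr0_norm// oppr_eq0 gt_eqF//.
  by move=> /(_ erefl isT) + /(_ erefl isT); rewrite mulNr; lra.
split => //; rewrite leNgt; apply/negP => l0.
have l0' : 0 < - l by rewrite oppr_gt0.
have [e e0 H] := is_derive_quotient f1l l0'.
pose r := Num.min d e / 2.
have r0 : 0 < r by rewrite divr_gt0// lt_min d0.
have rlt : r < Num.min d e by rewrite ltr_pdivrMr// mulr_natr mulr2n ltrDl lt_min d0.
move: rlt; rewrite lt_min => /andP[rd re].
have bnd s : 0 <= s <= 1 -> `|s * r| <= r.
  move=> /andP[s0 s1].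
  have r0' := ltW r0; rewrite ger0_norm; last exact: mulr_ge0.
  by rewrite -[leRHS]mul1r ler_wpM2r.
have [|s s01] := MVT_line (f := f) (df := f1) (z := x) (a := a) (t := r).
  by move=> s s01; apply: ff1; apply: le_lt_trans (bnd _ s01) rd.
have := fmin r; rewrite gtr0_norm// => /(_ rd); rewrite -subr_ge0 => + E.
rewrite {}E pmulr_rge0//.
have sr0 : 0 < s * r by case/andP: s01 => s0 _; exact: mulr_gt0.
have := H (s * r) (le_lt_trans (bnd _ _) re); rewrite ?gt_eqF// f10 subr0.
have s01' : 0 <= s <= 1 by case/andP: s01 => /ltW -> ->.
have sr0' : 0 < (s * r)^-1 by rewrite invr_gt0.
move=> /(_ s01' isT) + y0; have := mulr_ge0 (ltW sr0') y0.
by move=> q0; rewrite ger0_norm; lra.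
Qed.
End directional_calculus.

(** * Linearity of directional derivatives of C^1 functions *)

Section C1_along_theory.
Variables (R : realType) (U : normedModType R) (T D : set U).
Implicit Types (f g : U -> R) (x z a b w : U) (t l : R).

Lemma within_continuous_dist g z e : {within D, continuous g} -> D z -> 0 < e ->
  exists2 d, 0 < d & forall y, D y -> `|y - z| < d -> `|g y - g z| < e.
Proof.
move=> /subspace_continuousP gc Dz e0.
have /cvgrPdist_lt/(_ e e0) := gc z Dz.
move=> /nbhs_ballP[d /= d0 H]; exists d => // y Dy yz.
by rewrite distrC; apply: H => //; rewrite -ball_normE/= distrC.
Qed.

(** Relative openness covers two cases at once: open sets with [T = setT], and jets with symmetric
    matrix part, which need not form an open set. *)
Hypothesis subT : forall c a b, T a -> T b -> T (c *: a + b).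
Hypothesis openD : forall z, D z ->
  exists2 e, 0 < e & forall w, T w -> `|w| < e -> D (z + w).

Lemma subspace_mem0 a : T a -> T 0.
Proof. by move=> Ta; have := subT (- 1) Ta Ta; rewrite scaleN1r addNr. Qed.

Lemma subspace_memZ c a : T a -> T (c *: a).
Proof.
move=> Ta; rewrite -[c *: a]addr0.
by apply: subT => //; exact: subspace_mem0 Ta.
Qed.

Lemma is_derive_C1 f a z : C1_along T D f -> T a -> D z ->
  is_derive z a f ('D_a f z).
Proof. by move=> [_ fP] Ta Dz; apply: DeriveDef => //; exact: (fP a Ta).1. Qed.

(** The step from [z] to [z + h *: w] is split into the legs [h *: b] and [(h * c) *: a]. The first
    leg is a difference quotient at [z]; the second is, by the mean value theorem, a value of
    ['D_a f] near [z], which continuity brings back to [z]. *)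
Lemma derive_linear f c a b z : C1_along T D f -> T a -> T b -> D z ->
  'D_(c *: a + b) f z = c * 'D_a f z + 'D_b f z.
Proof.
move=> fC1 Ta Tb Dz; set w := c *: a + b.
have Tw : T w by exact: subT.
have [e e0 De] := openD Dz.
apply/eqP; rewrite -subr_eq0 -normr_le0; apply/ler_addgt0Pr => eps eps0; rewrite add0r.
have k0 : 0 < 2 + `|c| by rewrite ltr_pwDl.
(* The errors to come are two difference quotients, [eta] each, and [c] times a variation of
   ['D_a f], in total [(2 + |c|) * eta]. *)
pose eta := eps / (2 + `|c|); have eta0 : 0 < eta by rewrite divr_gt0.
have [d1 d10 H1] := is_derive_quotient (is_derive_C1 fC1 Tw Dz) eta0.
have [d2 d20 H2] := is_derive_quotient (is_derive_C1 fC1 Tb Dz) eta0.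
have [d3 d30 H3] := within_continuous_dist (fC1.2 a Ta).2 Dz eta0.
pose m := Num.min (Num.min d1 d2) (Num.min d3 e).
have m0 : 0 < m by rewrite !lt_min d10 d20 d30 e0.
pose K := 1 + `|b| + `|c *: a|.
have K0 : 0 < K by rewrite /K -addrA ltr_pwDl ?addr_ge0.
have K1 : 1 <= K by rewrite /K -addrA lerDl addr_ge0.
have [h [h0 hK hm]] : exists h, [/\ 0 < h, h * K < m & h < m].
  exists (m / (2 * K)); have h0 : 0 < m / (2 * K) by rewrite divr_gt0// mulr_gt0.
  have hK : m / (2 * K) * K < m.
    by rewrite invfM mulrA mulfVK ?gt_eqF// ltr_pdivrMr// mulr_natr mulr2n ltrDl.
  by split => //; rewrite (le_lt_trans _ hK)// ler_peMr// ltW.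
have hb s : 0 <= s <= 1 -> `|(s * (h * c)) *: a + h *: b| < m.
  move=> /andP[s0 s1]; apply: le_lt_trans hK.
  rewrite -!scalerA (le_trans (ler_normD _ _))// /K; move: (c *: a) => ca.
  rewrite !normrZ (ger0_norm s0) (gtr0_norm h0).
  have X0 := mulr_ge0 (ltW h0) (normr_ge0 ca).
  have : s * (h * `|ca|) <= h * `|ca| by rewrite -[leRHS]mul1r ler_wpM2r.
  by move: (mulr_ge0 (ltW h0) (normr_ge0 b)); lra.
have Tt s : T ((s * (h * c)) *: a + h *: b) by apply: subT => //; exact: subspace_memZ.
move: hm; rewrite /m !lt_min => /andP[/andP[hd1 hd2] /andP[hd3 he]].
have [|s s01] := MVT_line (f := f) (df := 'D_a f) (z := z + h *: b) (a := a) (t := h * c).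
  move=> s s01; apply: is_derive_C1 => //.
  rewrite -addrA [h *: b + _]addrC; apply: De => //.
  by have := hb _ s01; rewrite !lt_min => /andP[_ /andP[]].
have {s01}s01 : 0 <= s <= 1 by case/andP: s01 => /ltW -> ->.
have := hb _ s01; rewrite !lt_min => /andP[_ /andP[y3 ye]].
rewrite -!addrA ![h *: b + _ *: a]addrC.
set y := z + ((s * _) *: a + _).
have : `|'D_a f y - 'D_a f z| < eta.
  by apply: H3; [by apply: De|rewrite /y addrAC subrr add0r].
have := H1 h; rewrite gtr0_norm// gt_eqF// => /(_ hd1 isT).
have := H2 h; rewrite gtr0_norm// gt_eqF// => /(_ hd2 isT).
have -> : h *: w = (h * c) *: a + h *: b by rewrite scalerDr scalerA.
set fw := f (_ + (_ + _)); set fb := f (z + _); set Dy := 'D_a f y.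
move=> + + + fE; have -> : fw = fb + h * c * Dy by rewrite -fE addrC subrK.
have -> : h^-1 * (fb + h * c * Dy - f z) = h^-1 * (fb - f z) + c * Dy.
  by field; rewrite gt_eqF.
set q := h^-1 * _ => qb qw Dyz.
have -> : 'D_w f z - (c * 'D_a f z + 'D_b f z) =
    (q - 'D_b f z) - (q + c * Dy - 'D_w f z) + c * (Dy - 'D_a f z) by ring.
have -> : eps = eta + eta + `|c| * eta by rewrite /eta; field; rewrite gt_eqF.
apply: le_trans (ler_normD _ _) _; apply: lerD; last by rewrite normrM ler_wpM2l// ltW.
by apply: le_trans (ler_normB _ _) _; apply: lerD; apply: ltW.
Qed.

Lemma subspace_mem_sum (I : finType) (c : I -> R) (w : I -> U) a0 : T a0 ->
  (forall i, T (w i)) -> T (\sum_i c i *: w i).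
Proof.
move=> Ta0 Tw; elim/big_rec : _ => [|i y _ Ty]; first exact: subspace_mem0 Ta0.
exact: subT.
Qed.

Lemma derive_sumZ f (I : finType) (c : I -> R) (w : I -> U) z a0 :
  C1_along T D f -> T a0 -> (forall i, T (w i)) -> D z ->
  'D_(\sum_i c i *: w i) f z = \sum_i c i * 'D_(w i) f z.
Proof.
move=> fC1 Ta0 Tw Dz.
suff : T (\sum_i c i *: w i) /\
  'D_(\sum_i c i *: w i) f z = \sum_i c i * 'D_(w i) f z by case.
elim/big_rec2 : _ => [|i y1 y2 _ [Ty <-]].
  by rewrite derive0; split => //; exact: subspace_mem0 Ta0.
by split; [exact: subT|exact: derive_linear].
Qed.

End C1_along_theory.

Lemma open_addr (R : realType) (U : normedModType R) (D : set U) z :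
  open D -> D z ->
  exists2 e : R, 0 < e & forall w, setT w -> `|w| < e -> D (z + w).
Proof.
move=> oD Dz; have /nbhs_ballP[e /= e0 H] := open_nbhs_nbhs (conj oD Dz).
exists e => // w _ we; apply: H; rewrite -ball_normE/=.
by rewrite opprD addrA subrr sub0r normrN.
Qed.

(** * Symmetry of second derivatives *)

Section second_derivatives.
Variables (R : realType) (U : normedModType R) (D : set U) (f : U -> R).
Hypothesis openD : open D.
Hypothesis fC1 : C1_along setT D f.
Hypothesis fC2 : forall a, C1_along setT D ('D_a f).

(** The mean value theorem is applied to [x |-> f (x + r *: b) - f x] along [a], and to ['D_a f]
    along [b]. *)
Lemma second_difference z a b r : 0 < r ->
  (forall s s', 0 <= s <= 1 -> 0 <= s' <= 1 ->
    D (z + (s * r) *: a + (s' * r) *: b)) ->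
  exists s s', [/\ 0 <= s <= 1, 0 <= s' <= 1 &
    f (z + r *: a + r *: b) - f (z + r *: a) - f (z + r *: b) + f z
    = r ^+ 2 * 'D_b ('D_a f) (z + (s * r) *: a + (s' * r) *: b)].
Proof.
move=> r0 Dr.
have D0 s : 0 <= s <= 1 -> D (z + (s * r) *: a).
  move=> s01; have := Dr s 0 s01; rewrite mul0r scale0r addr0; apply.
  by rewrite lexx ler01.
have D1 s : 0 <= s <= 1 -> D (z + (s * r) *: a + r *: b).
  by move=> s01; have := Dr s 1 s01; rewrite mul1r; apply; rewrite lexx ler01.
pose g x := f (x + r *: b) - f x.
pose dg x := 'D_a f (x + r *: b) - 'D_a f x.
have [|s s01 Eg] := MVT_line (f := g) (df := dg) (z := z) (a := a) (t := r).
  move=> s s01; apply: is_deriveB; last by apply: is_derive_C1 fC1 _ (D0 _ s01).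
  by apply: is_derive_shift; apply: is_derive_C1 fC1 _ (D1 _ s01).
have {s01}s01 : 0 <= s <= 1 by case/andP: s01 => /ltW -> ->.
have [|s' s01' Eg'] := MVT_line (f := 'D_a f) (df := 'D_b ('D_a f))
    (z := z + (s * r) *: a) (a := b) (t := r).
  by move=> s' s01'; apply: is_derive_C1 (fC2 a) _ (Dr _ _ s01 s01').
have {s01'}s01' : 0 <= s' <= 1 by case/andP: s01' => /ltW -> ->.
exists s, s'; split => //.
by rewrite expr2 -mulrA -Eg' -[X in r * X]/(dg (z + (s * r) *: a)) -Eg /g; ring.
Qed.

(** The second difference is symmetric in [a] and [b], so the two mixed derivatives agree at some
    points [x] and [y] of an arbitrarily small parallelogram; continuity moves both points to
    [z]. *)
Lemma derive_comm a b z : D z -> 'D_b ('D_a f) z = 'D_a ('D_b f) z.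
Proof.
move=> Dz; apply/eqP; rewrite -subr_eq0 -normr_le0.
apply/ler_addgt0Pr => e e0; rewrite add0r.
have e2 : 0 < e / 2 by rewrite divr_gt0.
have [d0 d00 H0] := open_addr openD Dz.
have [d1 d10 H1] := within_continuous_dist (((fC2 a).2 b I).2) Dz e2.
have [d2 d20 H2] := within_continuous_dist (((fC2 b).2 a I).2) Dz e2.
pose m := Num.min d0 (Num.min d1 d2).
have m0 : 0 < m by rewrite !lt_min d00 d10 d20.
pose K := 1 + `|a| + `|b|.
have K0 : 0 < K by rewrite /K -addrA ltr_pwDl ?addr_ge0.
have [r [r0 rK]] : exists r, 0 < r /\ r * K < m.
  exists (m / (2 * K)); split; first by rewrite divr_gt0// mulr_gt0.
  by rewrite invfM mulrA mulfVK ?gt_eqF// ltr_pdivrMr// mulr_natr mulr2n ltrDl.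
have small s s' : 0 <= s <= 1 -> 0 <= s' <= 1 ->
    `|(s * r) *: a + (s' * r) *: b| < m.
  move=> /andP[s0 s1] /andP[s'0 s'1]; apply: le_lt_trans rK.
  rewrite (le_trans (ler_normD _ _))// !normrZ !ger0_norm ?mulr_ge0 ?(ltW r0)//.
  have H t w : t <= 1 -> t * r * `|w| <= r * `|w| :> R.
    by move=> t1; rewrite -mulrA -[leRHS]mul1r ler_wpM2r// mulr_ge0// ltW.
  by have := H U s a s1; have := H U s' b s'1; rewrite /K; lra.
have near s s' : 0 <= s <= 1 -> 0 <= s' <= 1 ->
  let y := z + (s * r) *: a + (s' * r) *: b in
  [/\ D y, `|y - z| < d1 & `|y - z| < d2].
  move=> s01 s01' y; have := small _ _ s01 s01'; rewrite /m !lt_min => /and3P[? ? ?].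
  rewrite /y -addrA; split; first exact: H0.
    by rewrite [z + _]addrC addrK.
  by rewrite [z + _]addrC addrK.
have [x [Dx x1 E]] : exists x, [/\ D x, `|x - z| < d1 &
    f (z + r *: a + r *: b) - f (z + r *: a) - f (z + r *: b) + f z
    = r ^+ 2 * 'D_b ('D_a f) x].
  have [|s [s' [s01 s01' E]]] := second_difference (z := z) (a := a) (b := b) r0.
    by move=> s s' h h'; case: (near _ _ h h').
  by exists (z + (s * r) *: a + (s' * r) *: b); have [] := near _ _ s01 s01'.
have [y [Dy y2 F]] : exists y, [/\ D y, `|y - z| < d2 &
    f (z + r *: b + r *: a) - f (z + r *: b) - f (z + r *: a) + f z
    = r ^+ 2 * 'D_a ('D_b f) y].
  have [|s [s' [s01 s01' F]]] := second_difference (z := z) (a := b) (b := a) r0.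
    by move=> s s' h h'; rewrite addrAC; case: (near _ _ h' h).
  exists (z + (s * r) *: b + (s' * r) *: a); split => //.
    by rewrite addrAC; case: (near _ _ s01' s01).
  by rewrite [z + _ + _]addrAC; case: (near _ _ s01' s01).
have XY : 'D_b ('D_a f) x = 'D_a ('D_b f) y.
  apply: (mulfI (_ : r ^+ 2 != 0)); first by rewrite expf_neq0 ?gt_eqF.
  rewrite -E -F [z + r *: b + r *: a]addrAC.
  by move: (f _) (f _) (f _) (f z) => c1 c2 c3 c4; ring.
have := H1 _ Dx x1; have := H2 _ Dy y2; rewrite XY.
move: ('D_a ('D_b f) y) ('D_b ('D_a f) z) ('D_a ('D_b f) z) => X X1 X2 h1 h2.
have -> : X1 - X2 = (X - X2) - (X - X1) by ring.
rewrite [leRHS]splitr; apply: le_trans (ler_normB _ _) _.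
by apply: lerD; apply: ltW; [exact: h1|exact: h2].
Qed.
End second_derivatives.

Lemma sum_delta (R : pzSemiRingType) (I : finType) (k : I) (G : I -> R) :
  \sum_i (i == k)%:R * G i = G k.
Proof.
by rewrite (bigD1 k)//= eqxx mul1r big1 ?addr0// => i /negPf ->; rewrite mul0r.
Qed.

(** * Quadratic forms and the trace of a product of psd matrices *)

Section quadratic_forms.
Variables (R : realType) (n : nat).
Implicit Types (A N : 'M[R]_n) (xi : 'rV[R]_n).

Definition qform N xi : R := \sum_i \sum_j N i j * (xi 0 i * xi 0 j).

Lemma qform_mx N xi : (xi *m N *m xi^T) 0 0 = qform N xi.
Proof.
rewrite mxE /qform exchange_big; apply: eq_bigr => j _ /=.
by rewrite !mxE mulr_suml; apply: eq_bigr => i _; rewrite mulrAC mulrC.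
Qed.

Lemma qform_line N xi (k : 'I_n) t : (forall i j, N i j = N j i) ->
  qform N (xi + t *: delta_mx 0 k) =
  qform N xi + 2 * t * (\sum_j N k j * xi 0 j) + t ^+ 2 * N k k.
Proof.
move=> symN.
transitivity (\sum_i \sum_j (N i j * (xi 0 i * xi 0 j) +
    t * ((j == k)%:R * (N i j * xi 0 i)) + t * ((i == k)%:R * (N i j * xi 0 j))
    + t ^+ 2 * ((i == k)%:R * ((j == k)%:R * N i j)))).
  by apply: eq_bigr => i _; apply: eq_bigr => j _; rewrite !mxE !eqxx/=; ring.
rewrite /qform; under eq_bigr do rewrite !big_split/= -!mulr_sumr !sum_delta.
rewrite !big_split/= -!mulr_sumr !sum_delta.
have -> : \sum_i N i k * xi 0 i = \sum_j N k j * xi 0 j.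
  by apply: eq_bigr => i _; rewrite symN.
by ring.
Qed.

(* Each step splits off the rank one part (row k)^T (row k) / N_kk, after which
   row k vanishes. *)
Lemma sum_mul_psd_ge0 A N (s : seq 'I_n) :
  (forall xi, 0 <= qform A xi) ->
  (forall i j, N i j = N j i) -> (forall xi, 0 <= qform N xi) ->
  (forall i j, i \notin s -> N i j = 0) ->
  0 <= \sum_i \sum_j A i j * N i j.
Proof.
move=> A0; elim: s N => [|k s IH] N symN psdN Ns.
  by rewrite big1// => i _; rewrite big1// => j _; rewrite Ns// mulr0.
have quad xi t : 0 <= qform N xi + 2 * t * (\sum_j N k j * xi 0 j) + t ^+ 2 * N k k.
  by rewrite -qform_line.
have Nk0 : 0 <= N k k.
  have := quad 0 1; rewrite /qform big1 ?big1 ?mulr0 ?add0r ?expr1n ?mul1r//.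
    by move=> j _; rewrite mxE mulr0.
  by move=> i _; rewrite big1// => j _; rewrite !mxE !mulr0.
have [Nk|Nk] := eqVneq (N k k) 0.
  apply: IH => // i j is_; have [->|ik] := eqVneq i k; last first.
    by rewrite Ns// inE negb_or ik.
  have := quad (delta_mx 0 j).
  set a := qform _ _; rewrite Nk (bigD1 j)//= big1 ?addr0 ?mxE ?eqxx ?mulr1; last first.
    by move=> l lj; rewrite mxE eqxx (negPf lj) mulr0.
  move=> H; apply/eqP/negPn/negP => N0.
  (* With a zero pivot the quadratic in [t] is affine; this [t] gives it the value -1. *)
  have := H (- (a + 1) / (2 * N k j)).
  have -> : a + 2 * (- (a + 1) / (2 * N k j)) * N k j +
    (- (a + 1) / (2 * N k j)) ^+ 2 * 0 = -1 by field.
  by rewrite oppr_ge0 ler10.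
pose N' := \matrix_(i, j) (N i j - N k i * N k j / N k k).
pose r : 'rV[R]_n := \row_i N k i.
have N'q xi : qform N' xi = qform N xi - (\sum_j N k j * xi 0 j) ^+ 2 / N k k.
  rewrite /qform expr2 big_distrlr/= mulr_suml -sumrB; apply: eq_bigr => i _.
  rewrite mulr_suml -sumrB; apply: eq_bigr => j _; rewrite mxE. by field.
have Nk1 : 0 < N k k by rewrite lt_neqAle eq_sym Nk.
have : 0 <= \sum_i \sum_j A i j * N' i j.
  apply: IH => [i j|xi|i j is_].
  - by rewrite !mxE symN [N k i * _]mulrC.
  - rewrite N'q; set b := \sum_j _.
    (* This [t] minimises the quadratic, and the minimum is the form of the Schur complement
       [N']. *)
    have := quad xi (- b / N k k); rewrite -/b.
    suff -> : qform N xi + 2 * (- b / N k k) * b + (- b / N k k) ^+ 2 * N k k =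
      qform N xi - b ^+ 2 / N k k by [].
    by field.
  - rewrite mxE; have [->|ik] := eqVneq i k; first by field.
    have Ni j' : N i j' = 0 by rewrite Ns// inE negb_or ik.
    by rewrite (symN k i) !Ni !mul0r subrr.
have rA : 0 <= qform A r / N k k by rewrite divr_ge0.
move=> H; apply: le_trans (addr_ge0 H rA) _; rewrite le_eqVlt; apply/orP; left; apply/eqP.
rewrite /qform mulr_suml -big_split/=; apply: eq_bigr => i _.
rewrite mulr_suml -big_split/=; apply: eq_bigr => j _; rewrite !mxE. by field.
Qed.
End quadratic_forms.

Lemma ler_norm_near (R : realDomainType) (a b e : R) :
  `|a - b| < e -> `|b| <= `|a| + e.
Proof.
move=> /ltW ab; rewrite -lerBlDl; apply: le_trans ab.
by rewrite distrC lerB_dist.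
Qed.

(** * Jets and the consequences of ellipticity *)

Section jets.
Variables (R : realType) (n : nat).
Implicit Types (M N : 'M[R]_n) (z w : jet R n).

Lemma jetD (x x' : 'rV[R]_n) (s s' : R) (p p' : 'rV[R]_n) M N :
  (x, s, p, M) + (x', s', p', N) = (x + x', s + s', p + p', M + N) :> jet R n.
Proof. by []. Qed.

Lemma jetZ c (x : 'rV[R]_n) (s : R) (p : 'rV[R]_n) M :
  c *: ((x, s, p, M) : jet R n) = (c *: x, c * s, c *: p, c *: M).
Proof. by []. Qed.

Lemma symmetricmxP M : reflect (forall i j, M i j = M j i) (M \is symmetricmx).
Proof.
apply: (iffP idP) => [/is_hermitianmxP MT i j|MT].
  by rewrite {1}MT expr0 scale1r !mxE.
by apply/is_hermitianmxP/matrixP => i j; rewrite expr0 scale1r !mxE.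
Qed.

Lemma symmetricmx_lin c M N : M \is symmetricmx -> N \is symmetricmx ->
  c *: M + N \is symmetricmx.
Proof.
move=> /symmetricmxP sM /symmetricmxP sN; apply/symmetricmxP => i j.
by rewrite !mxE sM sN.
Qed.

Lemma jet_dom_lin c z w :
  jet_dom setT z -> jet_dom setT w -> jet_dom setT (c *: z + w).
Proof. by move=> [_ sz] [_ sw]; split => //=; exact: symmetricmx_lin. Qed.

Lemma norm_jet z :
  [/\ `|z.1.1.1| <= `|z|, `|z.1.1.2| <= `|z|, `|z.1.2| <= `|z|
    & `|z.2| <= `|z|].
Proof.
rewrite !prod_normE/=.
by split; rewrite !le_max ?lexx ?orbT.
Qed.

Lemma norm_jet_le z e : `|z.1.1.1| <= e -> `|z.1.1.2| <= e -> `|z.1.2| <= e ->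
  `|z.2| <= e -> `|z| <= e.
Proof. by move=> h1 h2 h3 h4; rewrite !prod_normE/= !ge_max h1 h2 h3 h4. Qed.

Variable Omega : set 'rV[R]_n.
Hypothesis openO : open Omega.

Lemma jet_dom_open z : jet_dom Omega z ->
  exists2 e : R, 0 < e &
    forall w, jet_dom setT w -> `|w| < e -> jet_dom Omega (z + w).
Proof.
move=> [Oz sz]; have [e e0 H] := open_addr openO Oz.
exists e => // w [_ sw] we; split => /=.
  by apply: H => //; apply: le_lt_trans we; case: (norm_jet w).
by rewrite -[z.2]scale1r; exact: symmetricmx_lin.
Qed.

Variable F : jet R n -> R.
Hypothesis F_C1 : C1_operator Omega F.

(** A symmetric [N] is the sum over all ordered pairs of [N i j] times the symmetrised elementary
    matrix, the direction that defines [dF_dM]; linearity does the rest. *)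
Lemma derive_dF_dM z N : jet_dom Omega z -> N \is symmetricmx ->
  'D_((0, 0, 0, N) : jet R n) F z = \sum_i \sum_j N i j * dF_dM F z i j.
Proof.
move=> Dz /symmetricmxP symN.
pose w (p : 'I_n * 'I_n) : jet R n :=
  (0, 0, 0, 2^-1 *: (delta_mx p.1 p.2 + delta_mx p.2 p.1)).
have Tw p : jet_dom setT (w p).
  split => //; apply/symmetricmxP => i j; rewrite !mxE /=.
  by rewrite addrC; congr (_ * (_%:R + _%:R)); rewrite andbC.
have T0 : jet_dom setT (0 : jet R n).
  by split => //; apply/symmetricmxP => i j; rewrite !mxE.
have -> : 'D_((0, 0, 0, N) : jet R n) F z = 'D_(\sum_p N p.1 p.2 *: w p) F z.
  congr ('D_ _ F z).
  have -> : \sum_p N p.1 p.2 *: w p = (0, 0, 0, \sum_p N p.1 p.2 *: (w p).2).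
    elim/big_rec2 : _ => [//|p y1 y2 _ ->].
    by rewrite jetZ jetD !scaler0 mulr0 !addr0.
  congr (_, _); apply/matrixP => i j; rewrite summxE.
  rewrite (eq_bigr (fun p => (p == (i, j))%:R * (N p.1 p.2 / 2) +
                             (p == (j, i))%:R * (N p.1 p.2 / 2))); last first.
    move=> [k l] _; rewrite !mxE !xpair_eqE/=.
    rewrite ![i == _]eq_sym ![j == _]eq_sym [(l == i) && _]andbC; ring.
  by rewrite big_split/= !sum_delta/= (symN j i) -splitr.
rewrite (derive_sumZ jet_dom_lin jet_dom_open _ F_C1 T0 Tw Dz) pair_big/=.
by apply: eq_bigr => p _; rewrite [dF_dM _ _ _ _]mxE.
Qed.

Hypothesis F_elliptic : forall z, jet_dom Omega z -> posdefmx (- dF_dM F z).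

Lemma dF_qform_ge0 z xi : jet_dom Omega z -> 0 <= qform (- dF_dM F z) xi.
Proof.
move=> /F_elliptic [_ Fpos]; rewrite -qform_mx.
have [->|/Fpos/ltW//] := eqVneq xi 0.
by rewrite trmx0 mulmx0 mxE.
Qed.

(** By the mean value theorem the increment is minus the pairing of two psd matrices. There is no
    smallness condition on [N]: this absorbs the uncontrolled part of the Hessian of [u]. *)
Lemma elliptic_antimono x s p M N : jet_dom Omega (x, s, p, M) ->
  N \is symmetricmx -> (forall xi, 0 <= qform N xi) ->
  F (x, s, p, M + N) <= F (x, s, p, M).
Proof.
move=> [Ox sM] sN psdN.
have E t : (x, s, p, M) + t *: ((0, 0, 0, N) : jet R n) = (x, s, p, M + t *: N).
  by rewrite jetZ jetD !scaler0 mulr0 !addr0.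
have Dt t : jet_dom Omega ((x, s, p, M) + t *: ((0, 0, 0, N) : jet R n)).
  by rewrite E; split => //=; rewrite addrC; exact: symmetricmx_lin.
have [|t _] := MVT_line (f := F) (df := 'D_((0, 0, 0, N) : jet R n) F)
   (z := (x, s, p, M)) (a := (0, 0, 0, N)) (t := 1).
  by move=> t _; apply: is_derive_C1 F_C1 _ (Dt _).
rewrite mul1r E scale1r derive_dF_dM// => H; rewrite -subr_le0 {}H -oppr_ge0 -sumrN.
set z : jet R n := (x, s, p, M) + (t * 1) *: _.
rewrite (eq_bigr (fun i => \sum_j (- dF_dM F z) i j * N i j)); last first.
  move=> i _; rewrite -sumrN; apply: eq_bigr => j _.
  by rewrite [(- dF_dM F z) i j]mxE mulNr mulrC.
apply: (@sum_mul_psd_ge0 _ _ _ _ (enum 'I_n)) => //.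
- by move=> xi; apply: dF_qform_ge0; exact: Dt.
- exact/symmetricmxP.
- by move=> i j; rewrite mem_enum.
Qed.

Lemma derive_trace_lt0 z : (0 < n)%N -> jet_dom Omega z ->
  'D_((0, 0, 0, 1%:M) : jet R n) F z < 0.
Proof.
move=> n0 Dz.
rewrite derive_dF_dM//; last first.
  by apply/symmetricmxP => i j; rewrite !mxE eq_sym.
have dii i : dF_dM F z i i < 0.
  have [_ /(_ (delta_mx 0 i))] := F_elliptic Dz.
  rewrite trmx_delta -rowE -colE !mxE oppr_gt0; apply.
  by apply/eqP => /matrixP/(_ 0 i)/eqP; rewrite !mxE !eqxx oner_eq0.
rewrite (eq_bigr (fun i => dF_dM F z i i)); last first.
  move=> i _; rewrite -[RHS](sum_delta i (fun j => dF_dM F z i j)).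
  by apply: eq_bigr => j _; rewrite !mxE [j == i]eq_sym.
rewrite (bigD1 (Ordinal n0))//=.
have : \sum_(i | i != Ordinal n0) dF_dM F z i i <= 0.
  by apply: sumr_le0 => i _; exact: ltW.
by have := dii (Ordinal n0); lra.
Qed.

(** Finitely many directional derivatives of [F] are continuous at [z0], and linearity assembles
    them. The constants do not depend on [s], [q] and [B], so [B] can later be taken large against
    the other two. *)
Lemma elliptic_strict z0 : (0 < n)%N -> jet_dom Omega z0 ->
  exists c C d : R, [/\ 0 < c, 0 < C, 0 < d & forall z, jet_dom Omega z -> `|z - z0| < d ->
   forall s q B, 0 <= B ->
   'D_((0, s, q, B%:M) : jet R n) F z <= C * (`|s| + `|q|) - c * B].
Proof.
move=> n0 D0.
pose eM : jet R n := (0, 0, 0, 1%:M).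
pose eS : jet R n := (0, 1, 0, 0).
pose eP i : jet R n := (0, 0, delta_mx 0 i, 0).
have s0 : (0 : 'M[R]_n) \is symmetricmx.
  by apply/symmetricmxP => i j; rewrite !mxE.
have TM : jet_dom setT eM.
  by split => //; apply/symmetricmxP => i j; rewrite !mxE eq_sym.
have TS : jet_dom setT eS by split.
have TP i : jet_dom setT (eP i) by split.
have near a e : jet_dom setT a -> 0 < e ->
    \forall z \near within (jet_dom Omega) (nbhs z0), `|'D_a F z0 - 'D_a F z| < e.
  move=> Ta e0; have [_ /(_ a Ta) [_ /subspace_continuousP/(_ z0 D0)]] := F_C1.
  by move=> /cvgrPdist_lt; exact.
have M0 : 'D_eM F z0 < 0 by exact: derive_trace_lt0.
(* Half of the slope at [z0]: a deviation smaller than [c] still leaves a slope of at most [- c]. *)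
pose c := - 'D_eM F z0 / 2; have c0 : 0 < c by rewrite divr_gt0// oppr_gt0.
pose C := `|'D_eS F z0| + 1 + \sum_i (`|'D_(eP i) F z0| + 1).
have hP := @filter_forall _ _ (fun i z => `|'D_(eP i) F z0 - 'D_(eP i) F z| < 1)
  _ _ (fun i => near _ _ (TP i) ltr01).
have : nbhs z0 (fun z => jet_dom Omega z ->
    (`|'D_eM F z0 - 'D_eM F z| < c /\ `|'D_eS F z0 - 'D_eS F z| < 1) /\
    forall i, `|'D_(eP i) F z0 - 'D_(eP i) F z| < 1).
  exact: filterI (filterI (near _ _ TM c0) (near _ _ TS ltr01)) (hP _).
move=> /nbhs_ballP[d /= d0 H].
have SC : 0 <= \sum_i (`|'D_(eP i) F z0| + 1) by apply: sumr_ge0 => i _; rewrite addr_ge0.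
exists c, C, d; split => //; first by rewrite /C; have := normr_ge0 ('D_eS F z0); lra.
move=> z Dz zd s q B B0.
have [] := H z _ Dz; first by rewrite -ball_normE/= distrC.
move=> [hM hS] {}hP.
have -> : ((0, s, q, B%:M) : jet R n) = B *: eM + (s *: eS + \sum_i q 0 i *: eP i).
  have -> : \sum_i q 0 i *: eP i = ((0, 0, q, 0) : jet R n).
    rewrite [in RHS](row_sum_delta q).
    elim/big_rec2 : _ => [//|i y1 y2 _ ->].
    by rewrite jetZ jetD !scaler0 mulr0 !addr0.
  by rewrite !jetZ !jetD !scaler0 scalemx1 mulr0 mulr1 !addr0 !add0r.
have TPs : jet_dom setT (\sum_i q 0 i *: eP i).
  exact: (subspace_mem_sum jet_dom_lin _ TS TP).
rewrite !(derive_linear jet_dom_lin jet_dom_open _ F_C1)//; last exact: jet_dom_lin.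
rewrite (derive_sumZ jet_dom_lin jet_dom_open (fun i => q 0 i) F_C1 TS TP)//.
have bM : 'D_eM F z <= - c.
  move: hM; rewrite ltr_norml /c => /andP[].
  by move: ('D_eM F z) ('D_eM F z0) => a b; lra.
have bS : s * 'D_eS F z <= `|s| * (`|'D_eS F z0| + 1).
  rewrite (le_trans (ler_norm _))// normrM ler_wpM2l//.
  exact: ler_norm_near.
have bP i : q 0 i * 'D_(eP i) F z <= `|q| * (`|'D_(eP i) F z0| + 1).
  apply: le_trans (ler_norm _) _; rewrite normrM.
  apply: ler_pM; [exact: normr_ge0|exact: normr_ge0| |exact: ler_norm_near (hP i)].
  rewrite [leRHS]mx_normrE; apply/bigmax_geP; right.
  by exists (0, i).
have bPs : \sum_i q 0 i * 'D_(eP i) F z <= `|q| * \sum_i (`|'D_(eP i) F z0| + 1).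
  rewrite mulr_sumr; apply: ler_sum => i _; exact: bP.
have bM' : B * 'D_eM F z <= B * - c by exact: ler_wpM2l.
apply: le_trans (lerD bM' (lerD bS bPs)) _; rewrite /C.
move: SC; move: (\sum_i (_ + _)) => w w0.
have := mulr_ge0 (normr_ge0 s) w0; have := normr_ge0 q.
have := mulr_ge0 (normr_ge0 q) (normr_ge0 ('D_eS F z0)).
by move: `|s| `|q| `|_| => x y a; lra.
Qed.
End jets.

(** * The dot product and the barrier *)

Section dot_product.
Variables (R : realType) (n : nat).
Implicit Types (x y a V : 'rV[R]_n) (t : R).

Lemma dotC x y : dot x y = dot y x.
Proof. by apply: eq_bigr => i _; rewrite mulrC. Qed.

Lemma dotDr x y a : dot x (y + a) = dot x y + dot x a.
Proof. by rewrite -big_split; apply: eq_bigr => i _; rewrite mxE mulrDr. Qed.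

Lemma dotZr t x y : dot x (t *: y) = t * dot x y.
Proof. by rewrite mulr_sumr; apply: eq_bigr => i _; rewrite mxE mulrCA. Qed.

Lemma dotDl x y a : dot (y + a) x = dot y x + dot a x.
Proof. by rewrite dotC dotDr ![dot x _]dotC. Qed.

Lemma dotZl t x y : dot (t *: y) x = t * dot y x.
Proof. by rewrite dotC dotZr dotC. Qed.

Lemma dot_delta x i : dot x (delta_mx 0 i) = x 0 i.
Proof.
rewrite -[RHS](sum_delta i (fun j => x 0 j)).
by apply: eq_bigr => j _; rewrite mxE eqxx mulrC.
Qed.

Lemma dot_ge0 x : 0 <= dot x x.
Proof. by apply: sumr_ge0 => i _; rewrite -expr2 sqr_ge0. Qed.

Lemma ler_coord_norm x i : `|x 0 i| <= `|x|.
Proof. by rewrite [leRHS]mx_normrE; apply/bigmax_geP; right; exists (0, i). Qed.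

Lemma dot_le x y : `|dot x y| <= n%:R * (`|x| * `|y|).
Proof.
apply: le_trans (ler_norm_sum _ _ _) _.
have -> : n%:R * (`|x| * `|y|) = \sum_(i < n) `|x| * `|y|.
  by rewrite sumr_const card_ord mulr_natl.
apply: ler_sum => i _; rewrite normrM.
by apply: ler_pM; [exact: normr_ge0|exact: normr_ge0| |]; exact: ler_coord_norm.
Qed.

Lemma is_derive_quadratic (f : 'rV[R]_n -> R) x a (l k : R) :
  (forall t, f (x + t *: a) = f x + t * l + t ^+ 2 * k) -> is_derive x a f l.
Proof.
move=> fE; apply: is_derive_of_quotient => e e0.
have k0 : 0 < 1 + `|k| by rewrite ltr_pwDl.
exists (e / (1 + `|k|)); first exact: divr_gt0.
move=> t te t0; rewrite fE.
have -> : t^-1 * (f x + t * l + t ^+ 2 * k - f x) - l = t * k by field.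
rewrite normrM; move: te; rewrite ltr_pdivlMr// => /ltW; apply: le_trans.
by rewrite ler_wpM2l// lerDr.
Qed.

Definition barrier A V x := dot V x + A * dot x x.

Lemma barrierE A V x t a : barrier A V (x + t *: a) =
  barrier A V x + t * (dot V a + 2 * A * dot x a) + t ^+ 2 * (A * dot a a).
Proof. by rewrite /barrier !(dotDr, dotDl, dotZr, dotZl) [dot a x]dotC; ring. Qed.

End dot_product.

(** * First and second order conditions at a touching point *)

Section second_order_contact.
Variables (R : realType) (n : nat).
Implicit Types (D : set 'rV[R]_n) (f u v : 'rV[R]_n -> R) (x a V : 'rV[R]_n).

Lemma hessian_sym D f x : open D -> C2 D f -> D x -> hessian f x \is symmetricmx.
Proof.
move=> oD [f1 f2] Dx; apply/symmetricmxP => i j; rewrite !mxE.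
exact: derive_comm Dx.
Qed.

Let linT (c : R) a b : setT a -> setT b -> [set: 'rV[R]_n] (c *: a + b).
Proof. by []. Qed.

Lemma derive_grad D f x a : open D -> C1_along setT D f -> D x ->
  'D_a f x = dot (grad f x) a.
Proof.
move=> oD f1 Dx; rewrite {1}(row_sum_delta a).
rewrite (derive_sumZ linT (fun z => open_addr oD) _ f1 (a0 := 0))//.
by apply: eq_bigr => i _; rewrite mxE mulrC.
Qed.

(** Only the outer direction can be expanded by linearity, so the derivatives are swapped between
    the two expansions. *)
Lemma derive_hessian D f x a : open D -> C2 D f -> D x ->
  'D_a ('D_a f) x = qform (hessian f x) a.
Proof.
move=> oD [f1 f2] Dx; rewrite (derive_grad _ oD (f2 a) Dx) /dot/qform.
apply: eq_bigr => i _; rewrite mxE (derive_comm oD f1 f2)//.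
rewrite (derive_grad _ oD (f2 _) Dx) /dot mulr_suml.
by apply: eq_bigr => j _; rewrite !mxE; ring.
Qed.

Lemma contact D D' u v x A V eps (d : R) : open D -> D `<=` D' -> open D' ->
  C2 D u -> C2 D' v -> D x -> 0 < d ->
  (forall w, `|w| < d -> u x - v x - eps * barrier A V x <=
     u (x + w) - v (x + w) - eps * barrier A V (x + w)) ->
  grad u x = grad v x + eps *: (V + (2 * A) *: x) /\
  forall a, 0 <= qform (hessian u x - hessian v x - (eps * (2 * A))%:M) a.
Proof.
move=> oD DD' oD' u2 v2 Dx d0 umin.
have [e e0 He] := open_addr oD Dx.
have key a : 'D_a u x - 'D_a v x - eps * (dot V a + 2 * A * dot x a) = 0 /\
    0 <= 'D_a ('D_a u) x - 'D_a ('D_a v) x - eps * (2 * A * dot a a).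
  pose m := Num.min d e / (1 + `|a|).
  have a0 : 0 < 1 + `|a| by rewrite ltr_pwDl.
  have m0 : 0 < m by rewrite divr_gt0// lt_min d0.
  have ta t : `|t| < m -> `|t *: a| < d /\ `|t *: a| < e.
    rewrite ltr_pdivlMr// => tm; apply/andP; rewrite -lt_min normrZ.
    by apply: le_lt_trans tm; rewrite ler_wpM2l// lerDr.
  pose f y := u y - v y - eps * barrier A V y.
  pose f1 y := 'D_a u y - 'D_a v y - eps * (dot V a + 2 * A * dot y a).
  apply: (@is_derive_min _ _ f f1 x a _ m) => //.
  - by move=> t /ta[/umin].
  - move=> t /ta[_ /(He _ I) Dt].
    apply: is_deriveB; last first.
      apply: (@is_derive_quadratic _ _ (fun y => eps * barrier A V y) _ _ _ (eps * (A * dot a a))).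
      by move=> s; rewrite barrierE; ring.
    apply: is_deriveB; first exact: is_derive_C1 u2.1 _ Dt.
    exact: is_derive_C1 v2.1 _ (DD' _ Dt).
  - apply: is_deriveB; last first.
      apply: (@is_derive_quadratic _ _ (fun y => eps * (dot V a + 2 * A * dot y a)) _ _ _ 0).
      by move=> s; rewrite dotDl dotZl; ring.
    apply: is_deriveB; first exact: is_derive_C1 (u2.2 a) _ Dx.
    exact: is_derive_C1 (v2.2 a) _ (DD' _ Dx).
split.
  apply/rowP => i; have [+ _] := key (delta_mx 0 i).
  rewrite !dot_delta !mxE => /eqP; rewrite subr_eq0 subr_eq => /eqP ->.
  by rewrite addrC.
move=> a; have [_] := key a.
rewrite (derive_hessian _ oD u2 Dx) (derive_hessian _ oD' v2 (DD' _ Dx)).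
move: (hessian u x) (hessian v x) => Hu Hv; congr (0 <= _).
rewrite /qform /dot !mulr_sumr -!sumrB; apply: eq_bigr => i _.
rewrite -[eps * _](sum_delta i (fun j => eps * (2 * A * (a 0 i * a 0 j)))).
rewrite -!sumrB; apply: eq_bigr => j _; rewrite !mxE [j == i]eq_sym.
by case: (i == j); rewrite ?mulr1n ?mulr0n; ring.
Qed.
End second_order_contact.

(** * Continuity and size of the barrier, compact annuli *)

Section barrier_continuity.
Variables (R : realType) (n : nat).

Lemma continuous_dotr (f g : 'rV[R]_n -> 'rV[R]_n) :
  continuous f -> continuous g -> continuous (fun x => dot (f x) (g x)).
Proof.
move=> fc gc.
suff H s : continuous (fun x => \sum_(i <- s) f x 0 i * g x 0 i) by exact: H.
elim: s => [|i s IH] x.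
  rewrite (_ : (fun x => _) = cst 0); first exact: cst_continuous.
  by apply/funext => y; rewrite big_nil.
rewrite (_ : (fun x => _) = fun x => f x 0 i * g x 0 i + \sum_(i <- s) f x 0 i * g x 0 i);
  last by apply/funext => y; rewrite big_cons.
apply: (@continuousD _ _ _ (fun y => f y 0 i * g y 0 i)
  (fun y => \sum_(i <- s) f y 0 i * g y 0 i)); last exact: IH.
apply: continuousM.
  apply: (@continuous_comp _ _ _ f (fun y => y 0 i)); first exact: fc.
  exact: coord_continuous.
apply: (@continuous_comp _ _ _ g (fun y => y 0 i)); first exact: gc.
exact: coord_continuous.
Qed.

Lemma continuous_barrier (A : R) V : continuous (@barrier R n A V).
Proof.
move=> x; apply: (@continuousD _ _ _ (fun y => dot V y) (fun y => A * dot y y)).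
  by apply: (@continuous_dotr (cst V) id) => y; [exact: cst_continuous|exact: cvg_id].
apply: (@continuousM _ _ (cst A) (fun y => dot y y)); first exact: cst_continuous.
by apply: (@continuous_dotr id id) => y; exact: cvg_id.
Qed.

(** Each of the two terms is at most [n |x|], the quadratic one because [A |x| <= 1]. That [A] is
    absent from the bound is what lets [A] be chosen large against it. *)
Lemma barrier_bound (A r : R) V (x : 'rV[R]_n) : 0 <= A -> A * r <= 1 ->
  `|V| <= 1 -> `|x| <= r -> barrier A V x <= 2 * n%:R * `|x|.
Proof.
move=> A0 Ar V1 xr; rewrite /barrier.
have h1 := le_trans (ler_norm _) (dot_le V x).
have h2 := le_trans (ler_norm _) (dot_le x x).
have h3 : `|V| * `|x| <= `|x| by rewrite -[leRHS]mul1r ler_wpM2r.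
have h4 : A * (`|x| * `|x|) <= `|x|.
  rewrite mulrA -[leRHS]mul1r ler_wpM2r//.
  by apply: le_trans Ar; rewrite ler_wpM2l.
have h5 : n%:R * (`|V| * `|x|) <= n%:R * `|x| by rewrite ler_wpM2l.
have h6 : A * (n%:R * (`|x| * `|x|)) <= n%:R * `|x| by rewrite mulrCA ler_wpM2l.
by have := ler_wpM2l A0 h2; lra.
Qed.

Lemma annulus_compact (r s : R) : compact [set x : 'rV[R]_n | r <= `|x| <= s].
Proof.
apply: bounded_closed_compact.
  exists s; split; first exact: num_real.
  by move=> M sM x /= /andP[_ xs]; rewrite (le_trans xs)// ltW.
have -> : [set x : 'rV[R]_n | r <= `|x| <= s] =
    Num.norm @^-1` [set y | r <= y] `&` Num.norm @^-1` [set y | y <= s].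
  by apply/seteqP; split => x /=; [move=> /andP[]|move=> [-> ->]].
apply: closedI; apply: preimage_closed.
- by move=> x _; exact: norm_continuous.
- exact: closed_ge.
- by move=> x _; exact: norm_continuous.
- exact: closed_le.
Qed.

Lemma open_punctured (D : set 'rV[R]_n) : open D -> open (D `\ 0).
Proof.
move=> oD; apply: openI => //; apply: closed_openC.
exact: accessible_closed_set1 (hausdorff_accessible (@norm_hausdorff _ _)) _.
Qed.

End barrier_continuity.

(** * Continuity of the jet of a C^2 function *)

Section jet_continuity.
Variables (R : realType) (n : nat) (D : set 'rV[R]_n).

Definition jet_at (f : 'rV[R]_n -> R) x : jet R n :=
  (x, f x, grad f x, hessian f x).

Lemma norm_mx_le p q (M : 'M[R]_(p, q)) (e : R) : 0 <= e ->
  (forall i j, `|M i j| <= e) -> `|M| <= e.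
Proof.
move=> e0 Me; rewrite [leLHS]mx_normrE; by apply: bigmax_le => // -[i j] _ /=.
Qed.

Lemma jet_at_near (v : 'rV[R]_n -> R) x0 e : open D -> C2 D v -> D x0 -> 0 < e ->
  exists2 r, 0 < r & forall x, `|x - x0| < r -> D x /\ `|jet_at v x - jet_at v x0| <= e.
Proof.
move=> oD v2 Dx0 e0.
have near (g : 'rV[R]_n -> R) : {within D, continuous g} ->
    \forall x \near x0, D x /\ `|g x - g x0| < e.
  move=> gc; have [d d0 H] := within_continuous_dist gc Dx0 e0.
  have [d' d'0 H'] := open_addr oD Dx0.
  apply/nbhs_ballP; exists (Num.min d d'); first by rewrite /= lt_min d0.
  move=> x; rewrite -ball_normE/= distrC lt_min => /andP[xd xd'].
  have Dx : D x by rewrite -[x](subrK x0) addrC; exact: H'.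
  by split => //; exact: H.
have n1 := near _ v2.1.1.
have n2 := @filter_forall _ _ _ _ _ (fun i => near _ (v2.1.2 (delta_mx 0 i) I).2).
have n3 := @filter_forall _ _ _ _ _ (fun p : 'I_n * 'I_n =>
  near _ ((v2.2 (delta_mx 0 p.1)).2 (delta_mx 0 p.2) I).2).
have : nbhs x0 (fun x => ((D x /\ `|v x - v x0| < e) /\
   (forall i, D x /\ `|'D_(delta_mx 0 i) v x - 'D_(delta_mx 0 i) v x0| < e)) /\
   forall p : 'I_n * 'I_n, D x /\ `|'D_(delta_mx 0 p.2) ('D_(delta_mx 0 p.1) v) x -
      'D_(delta_mx 0 p.2) ('D_(delta_mx 0 p.1) v) x0| < e).
  exact: filterI (filterI n1 (n2 _)) (n3 _).
move=> /nbhs_ballP[d /= d0 H]; exists (Num.min d e); first by rewrite lt_min d0.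
move=> x; rewrite lt_min => /andP[xd xe].
have [] := H x; first by rewrite -ball_normE/= distrC.
move=> [[Dx h1] h2] h3; split => //.
have e0' := ltW e0.
apply: norm_jet_le; [exact: ltW|exact: ltW| |].
- apply: norm_mx_le => // i j; rewrite ord1 /jet_at/= 3!mxE.
  rewrite [X in - X]mxE; exact: ltW (h2 j).2.
- apply: norm_mx_le => // i j; rewrite /jet_at/= 3!mxE.
  rewrite [X in - X]mxE; exact: ltW (h3 (i, j)).2.
Qed.
End jet_continuity.

(** * Ellipticity excludes touching by the barrier *)

Section barrier_argument.
Variables (R : realType) (n : nat) (Omega : set 'rV[R]_n).
Variables (F : jet R n -> R) (u v : 'rV[R]_n -> R).
Hypotheses (openO : open Omega) (Omega0 : Omega 0) (n_gt0 : (0 < n)%N).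
Hypothesis F_C1 : C1_operator Omega F.
Hypothesis F_elliptic : forall z, jet_dom Omega z -> posdefmx (- dF_dM F z).
Hypotheses (u_C2 : C2 (Omega `\ 0) u) (v_C2 : C2 Omega v).
Hypothesis v_lt_u : forall x, (Omega `\ 0) x -> v x < u x.
Hypothesis F_ge : forall x, (Omega `\ 0) x ->
  F (x, v x, grad v x, hessian v x) <= F (x, u x, grad u x, hessian u x).

Let sub_punctured : Omega `\ 0 `<=` Omega. Proof. by move=> x []. Qed.

Lemma jet_at_dom x : Omega x -> jet_dom Omega (jet_at v x).
Proof. by move=> Ox; split => //; exact: hessian_sym v_C2 Ox. Qed.

Lemma jet_perturb x sigma (q : 'rV[R]_n) B t :
  jet_at v x + t *: ((0, sigma, q, B%:M) : jet R n) =
  (x, v x + t * sigma, grad v x + t *: q, hessian v x + (t * B)%:M).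
Proof. by rewrite jetZ jetD scaler0 addr0 scale_scalar_mx. Qed.

(** At a minimum the jet of [u] would be that of [v], plus [eps] times the given direction, plus a
    psd matrix. The direction strictly lowers [F], the psd matrix does not raise it, and this
    contradicts [F_ge]. *)
Lemma no_contact x V A eps : (Omega `\ 0) x ->
  u x - v x - eps * barrier A V x < 0 -> 0 < eps ->
  (forall t, 0 <= t <= eps ->
    'D_((0, (u x - v x) / eps, V + (2 * A) *: x, (2 * A)%:M) : jet R n) F
      (jet_at v x + t *: ((0, (u x - v x) / eps, V + (2 * A) *: x, (2 * A)%:M) : jet R n)) < 0) ->
  forall d, 0 < d ->
  exists2 w, `|w| < d & u (x + w) - v (x + w) - eps * barrier A V (x + w) <
     u x - v x - eps * barrier A V x.
Proof.
move=> Ox neg eps0 Dneg d d0; apply/not_exists2P => H.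
have umin w : `|w| < d -> u x - v x - eps * barrier A V x <=
     u (x + w) - v (x + w) - eps * barrier A V (x + w).
  by move=> wd; rewrite leNgt; apply/negP => K; case: (H w).
have [gradE psdN] := contact (open_punctured openO) sub_punctured openO u_C2 v_C2
  Ox d0 umin.
set a : jet R n := (0, _, _, _) in Dneg.
have Ta : jet_dom setT a.
  by split => //; apply/symmetricmxP => i j; rewrite !mxE eq_sym.
have Ox' := sub_punctured Ox.
have Dt t : jet_dom Omega (jet_at v x + t *: a).
  rewrite jet_perturb; split => //=; rewrite -[hessian v x]scale1r.
  apply: symmetricmx_lin; first exact: hessian_sym v_C2 Ox'.
  by apply/symmetricmxP => i j; rewrite !mxE eq_sym.
have [|s /andP[s0 s1]] := MVT_line (f := F) (df := 'D_a F) (z := jet_at v x) (a := a) (t := eps).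
  by move=> s _; exact: is_derive_C1 F_C1 Ta (Dt _).
have Dn : 'D_a F (jet_at v x + (s * eps) *: a) < 0.
  apply: Dneg; rewrite mulr_ge0 ?(ltW s0) ?(ltW eps0)//=.
  by rewrite -[leRHS]mul1r ler_wpM2r// ltW.
move=> E; have : F (jet_at v x + eps *: a) < F (jet_at v x).
  by rewrite -subr_lt0 E pmulr_rlt0.
apply/negP; rewrite -leNgt; apply: le_trans (F_ge Ox) _.
(* At [t = eps] the perturbed jet already has the position, value and gradient of [u]; only the
   Hessian differs, by the psd matrix from [contact]. *)
move: (Dt eps); rewrite jet_perturb mulrCA divff ?gt_eqF// mulr1 -gradE.
rewrite [v x + _]addrC subrK => Deps.
have NE (M P Q : 'M[R]_n) : Q - M - P = - 1 *: (M + P) + Q.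
  by rewrite -addrA -opprD scaleN1r addrC.
have := elliptic_antimono openO F_C1 F_elliptic Deps _ psdN.
rewrite NE scaleN1r addrA subrr add0r; apply.
rewrite -scaleN1r; apply: symmetricmx_lin; first by case: Deps.
exact: hessian_sym (open_punctured openO) u_C2 Ox.
Qed.

(** Negativity together with [v < u] puts [(u x - v x) / eps] between 0 and the barrier, hence below
    [2 n]; and [V + 2 A x] has norm at most 3 when [A |x| <= 1]. The identity component then
    dominates in [elliptic_strict]. *)
Lemma barrier_contact_lt0 : exists A eps0 r0 : R, [/\ 0 < A, 0 < eps0, 0 < r0, A * r0 <= 1 &

  forall eps V x, 0 < eps -> eps <= eps0 -> `|V| <= 1 ->
   (Omega `\ 0) x -> `|x| <= r0 -> u x - v x - eps * barrier A V x < 0 ->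
   forall t, 0 <= t <= eps ->
    'D_((0, (u x - v x) / eps, V + (2 * A) *: x, (2 * A)%:M) : jet R n) F
      (jet_at v x + t *: ((0, (u x - v x) / eps, V + (2 * A) *: x, (2 * A)%:M) : jet R n)) < 0].
Proof.
have [c [C [d [c0 C0 d0 H]]]] :=
  elliptic_strict openO F_C1 F_elliptic n_gt0 (jet_at_dom Omega0).
have d4 : 0 < d / 4 by rewrite divr_gt0.
have d44 : d / 4 + d / 4 < d by lra.
have [r1 r10 H1] := jet_at_near openO v_C2 Omega0 d4.
pose N : R := n%:R; have N0 : 0 <= N by [].
have NK : 2 * N + 3 < 2 * (2 * N + 4) by lra.
(* Chosen so that [c * (2 * A)] equals [2 * C * (2 * N + 4)], which exceeds the competing term
   [C * (2 * N + 3)]. *)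
pose A := C * (2 * N + 4) / c.
have A0 : 0 < A by rewrite divr_gt0// mulr_gt0//; lra.
pose r0 := Num.min (r1 / 2) (Num.min 1 A^-1).
have r00 : 0 < r0 by rewrite !lt_min divr_gt0//= ltr01 invr_gt0.
have r01 : r0 <= 1 by rewrite !ge_min lexx orbT.
have Ar0 : A * r0 <= 1.
  have : r0 <= A^-1 by rewrite !ge_min lexx !orbT.
  by rewrite -(ler_pM2l A0) divff// gt_eqF.
have r0r1 : r0 < r1.
  apply: (@le_lt_trans _ _ (r1 / 2)); first by rewrite ge_min lexx.
  by rewrite ltr_pdivrMr// mulr_natr mulr2n ltrDl.
(* A bound for the norm of the whole direction. With [eps <= d / (4 * K)] the perturbation costs at
   most [d / 4], and moving from 0 to [x] another [d / 4]. *)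
pose K := 2 * N + 3 + 2 * A.
have K0 : 0 < K by rewrite /K; lra.
exists A, (d / (4 * K)), r0; split => //; first by rewrite divr_gt0// mulr_gt0.
move=> eps V x eps0 epsle V1 Ox xr0 neg t /andP[t0 teps].
have Ox' := sub_punctured Ox.
set s := _ / eps; set q := V + _.
have bar : barrier A V x <= 2 * N.
  have := barrier_bound (ltW A0) Ar0 V1 xr0; rewrite -/N.
  by have := ler_wpM2l N0 (le_trans xr0 r01); lra.
have uv0 : 0 < u x - v x by rewrite subr_gt0; exact: v_lt_u.
have s_ge0 : 0 <= s by rewrite divr_ge0// ltW.
have sle : `|s| <= 2 * N.
  rewrite ger0_norm// /s ler_pdivrMr//.
  have := ler_wpM2l (ltW eps0) bar; move: neg; rewrite mulrC; lra.
have qle : `|q| <= 3.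
  apply: le_trans (ler_normD _ _) _; rewrite normrZ ger0_norm; last by rewrite mulr_ge0// ltW.
  by have := ler_wpM2l (ltW A0) xr0; move: V1 Ar0; lra.
have A20 : 0 <= 2 * A by rewrite mulr_ge0// ltW.
have aK : `|((0, s, q, (2 * A)%:M) : jet R n)| <= K.
  apply: norm_jet_le => /=; rewrite ?normr0.
  - exact: ltW.
  - by rewrite (le_trans sle)// /K; lra.
  - by rewrite (le_trans qle)// /K; lra.
  - apply: norm_mx_le; first exact: ltW.
    move=> i j; rewrite mxE; case: (i == j); rewrite ?mulr1n ?mulr0n ?normr0 ?(ltW K0)//.
    by rewrite ger0_norm// /K; lra.
have tK : t * K <= d / 4.
  have := ler_pM t0 (ltW K0) (le_trans teps epsle) (lexx K).
  by rewrite invfM mulrA mulfVK// gt_eqF.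
have [Dx jx] : Omega x /\ `|jet_at v x - jet_at v 0| <= d / 4.
  by apply: H1; rewrite subr0 (le_lt_trans xr0).
set w : jet R n := (0, s, q, _) in aK *.
have := H (jet_at v x + t *: w).
move=> /(_ _ _ s q (2 * A) A20) HH; apply: le_lt_trans (HH _ _) _.
- rewrite jet_perturb; split => //=; rewrite -[hessian v x]scale1r.
  apply: symmetricmx_lin; first exact: hessian_sym v_C2 Ox'.
  by apply/symmetricmxP => i j; rewrite !mxE eq_sym.
- rewrite addrAC; apply: le_lt_trans (ler_normD _ _) _; rewrite normrZ (ger0_norm t0).
  apply: le_lt_trans (lerD jx (le_trans (ler_wpM2l t0 aK) tK)) _.
  exact: d44.
have -> : c * (2 * A) = C * (2 * (2 * N + 4)).
  by rewrite /A mulrCA [c * _]mulrC divfK ?gt_eqF// mulrCA.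
rewrite -mulrBr pmulr_rlt0// subr_lt0; apply: le_lt_trans (lerD sle qle) _.
exact: NK.
Qed.

Lemma barrier_no_minimum : exists A eps0 r0 : R,
  [/\ 0 < A, 0 < eps0, 0 < r0, A * r0 <= 1 &
  forall eps V x, 0 < eps -> eps <= eps0 -> `|V| <= 1 ->
    (Omega `\ 0) x -> `|x| <= r0 -> u x - v x - eps * barrier A V x < 0 ->
  forall d, 0 < d -> exists2 w, `|w| < d &
    u (x + w) - v (x + w) - eps * barrier A V (x + w) <
    u x - v x - eps * barrier A V x].
Proof.
have [A [eps0 [r0 [A0 e0 r00 Ar H]]]] := barrier_contact_lt0.
exists A, eps0, r0; split => // eps V x eps_gt0 epsle V1 Ox xr neg.
by apply: no_contact => //; exact: H.
Qed.

End barrier_argument.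

(** * Comparison of [u - v] with the barriers *)

Section comparison_with_barrier.
Variables (R : realType) (n : nat) (Omega : set 'rV[R]_n).
Variables (u v : 'rV[R]_n -> R).
Hypotheses (openO : open Omega) (Omega0 : Omega 0).
Hypotheses (u_cont : {within Omega `\ 0, continuous u}).
Hypotheses (v_cont : {within Omega, continuous v}).
Hypothesis v_lt_u : forall x, (Omega `\ 0) x -> v x < u x.

Lemma barrier_gap_continuous A V eps (K : set 'rV[R]_n) : K `<=` Omega `\ 0 ->
  {within K, continuous (fun x => u x - v x - eps * barrier A V x)}.
Proof.
move=> KO x.
have uc : {within K, continuous u} by exact: continuous_subspaceW KO u_cont.
have vc : {within K, continuous v}.
  by apply: continuous_subspaceW v_cont => y /KO[].
have bc : {within K, continuous (barrier A V)}.
  by apply: continuous_subspaceT; exact: continuous_barrier.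
apply: (@continuousB _ _ _ (fun x : subspace K => u x - v x)
  (fun x : subspace K => eps * barrier A V x)).
  apply: (@continuousB _ _ _ (u : subspace K -> R) (v : subspace K -> R)).
    exact: uc.
  exact: vc.
apply: (@continuousM _ _ (cst eps) (barrier A V : subspace K -> R)).
  exact: cst_continuous.
exact: bc.
Qed.

Lemma barrier_le (A eps0 r0 : R) : 0 < A -> 0 < eps0 -> 0 < r0 -> A * r0 <= 1 ->
  (forall eps V x, 0 < eps -> eps <= eps0 -> `|V| <= 1 ->
    (Omega `\ 0) x -> `|x| <= r0 -> u x - v x - eps * barrier A V x < 0 ->
  forall d, 0 < d -> exists2 w, `|w| < d &
    u (x + w) - v (x + w) - eps * barrier A V (x + w) <
    u x - v x - eps * barrier A V x) ->
  exists eps r, [/\ 0 < eps, 0 < r & forall V x, `|V| <= 1 ->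
    x != 0 -> `|x| <= r -> Omega x /\ eps * barrier A V x <= u x - v x].
Proof.
move=> A0 eps00 r00 Ar0 nomin.
have [e1 e10 He] := open_addr openO Omega0.
pose r := Num.min r0 (Num.min (e1 / 2) 1).
have r_gt0 : 0 < r by rewrite !lt_min r00 ltr01 divr_gt0.
have rr0 : r <= r0 by rewrite ge_min lexx.
have r1 : r <= 1 by rewrite !ge_min lexx !orbT.
have re1 : r < e1.
  apply: (@le_lt_trans _ _ (e1 / 2)); first by rewrite !ge_min lexx orbT.
  by rewrite ltr_pdivrMr// mulr_natr mulr2n ltrDl.
have Ar : A * r <= 1 by apply: le_trans Ar0; rewrite ler_wpM2l// ltW.
have rO x : `|x| <= r -> Omega x.
  by move=> xr; rewrite -[x]add0r; apply: He => //; exact: le_lt_trans re1.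
have KO s : 0 < s -> [set x : 'rV[R]_n | s <= `|x| <= r] `<=` Omega `\ 0.
  move=> s0 x /= /andP[sx xr]; split; first exact: rO.
  by move=> x0; move: sx; rewrite x0 normr0 leNgt s0.
have [del del0 Hdel] : exists2 del, 0 < del &
    forall x : 'rV[R]_n, `|x| = r -> del <= u x - v x.
  have [S0|/set0P S0] := eqVneq [set x : 'rV[R]_n | r <= `|x| <= r] set0.
    exists 1 => // x xr.
    have : [set x : 'rV[R]_n | r <= `|x| <= r] x by rewrite /= xr lexx.
    by rewrite S0.
  (* With all parameters zero the gap function is [u - v] itself. *)
  have [x /set_mem xS xmin] := compact_EVT_min S0 (@annulus_compact _ _ r r)
    (@barrier_gap_continuous 0 0 0 _ (KO _ r_gt0)).
  exists (u x - v x); first by rewrite subr_gt0; apply: v_lt_u; exact: KO xS.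
  move=> y yr; have := xmin y; rewrite !mul0r !subr0; apply.
  by apply/mem_set; rewrite /= yr lexx.
pose N : R := n%:R; have N0 : 0 <= N by [].
have N1 : 0 < 2 * N + 1 by lra.
(* Since [r <= 1], this keeps [eps] times the barrier at most [del] on the sphere of radius [r], for
   every admissible [V]; a negative minimum cannot lie there. *)
pose eps := Num.min eps0 (del / (2 * N + 1)).
have eps_gt0 : 0 < eps by rewrite lt_min eps00 divr_gt0.
have bar_le (V x : 'rV[R]_n) : `|V| <= 1 -> `|x| <= r -> eps * barrier A V x <= eps * (2 * N * `|x|).
  move=> V1 xr; rewrite ler_pM2l//.
  exact: barrier_bound (ltW A0) Ar V1 xr.
exists eps, r; split => // V x1 V1 x10 x1r; split; first exact: rO.
rewrite -subr_ge0 leNgt; apply/negP => neg.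
pose psi x := u x - v x - eps * barrier A V x.
(* For [|x| <= rho], [u > v] and the linear bound on the barrier give [psi x >= psi x1]. Hence the
   minimum over the compact annulus, which contains [x1], is a minimum over the whole punctured
   ball. *)
pose rho := Num.min `|x1| (- psi x1 / (eps * (2 * N + 1))).
have x1n : 0 < `|x1| by rewrite normr_gt0.
have k0 : 0 < eps * (2 * N + 1) by exact: mulr_gt0.
have rho0 : 0 < rho by rewrite lt_min x1n divr_gt0// oppr_gt0.
have small x : x != 0 -> `|x| <= rho -> psi x1 <= psi x.
  move=> x0 xrho.
  have xr : `|x| <= r by rewrite (le_trans xrho)// ge_min x1r.
  have : `|x| <= - psi x1 / (eps * (2 * N + 1)) by rewrite (le_trans xrho)// ge_min lexx orbT.
  rewrite ler_pdivlMr// => h1.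
  have h2 : v x < u x by apply: v_lt_u; split; [exact: rO|exact/eqP].
  have h3 := bar_le _ _ V1 xr.
  have h4 := mulr_ge0 (ltW eps_gt0) (normr_ge0 x).
  move: h1 h2 h3 h4; rewrite [psi x]/psi.
  move: (psi x1) (u x) (v x) (eps * barrier _ _ _) `|x| => a b c d e.
  by nra.
have Kx1 : [set x : 'rV[R]_n | rho <= `|x| <= r] x1 by rewrite /= x1r ge_min lexx.
have [x0 /set_mem xS xmin] := compact_EVT_min (ex_intro _ x1 Kx1) (@annulus_compact _ _ rho r)
    (@barrier_gap_continuous A V eps _ (KO _ rho0)).
have x01 : psi x0 <= psi x1 by apply: xmin; exact/mem_set.
have x0neg : psi x0 < 0 by exact: le_lt_trans neg.
have Ox0 := KO _ rho0 _ xS.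
case/andP: (xS) => rx0 x0r.
have x0r' : `|x0| < r.
  rewrite lt_neqAle x0r andbT; apply/negP => /eqP x0E.
  have h1 := Hdel _ x0E; have h2 := bar_le _ _ V1 x0r.
  have h3 : eps * (2 * N * `|x0|) <= del.
    have : eps <= del / (2 * N + 1) by rewrite ge_min lexx orbT.
    rewrite ler_pdivlMr// => h3; apply: le_trans h3; rewrite ler_pM2l// x0E.
    by have := ler_wpM2l N0 r1; lra.
  move: x0neg; rewrite /psi ltNge subr_ge0 => /negP; apply.
  exact: le_trans h2 (le_trans h3 h1).
have x0p : 0 < `|x0| by exact: lt_le_trans rx0.
(* Displacements below this size keep [x0 + w] in the ball of radius [r] and away from 0. *)
have m0 : 0 < Num.min (r - `|x0|) `|x0| by rewrite lt_min subr_gt0 x0r' x0p.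
have epsle : eps <= eps0 by rewrite ge_min lexx.
have [w] := nomin eps V x0 eps_gt0 epsle V1 Ox0 (le_trans x0r rr0) x0neg _ m0.
rewrite lt_min => /andP[w1 w2]; apply/negP; rewrite -leNgt.
have yr : `|x0 + w| <= r.
  by rewrite (le_trans (ler_normD _ _))// -lerBrDl ltW.
have y0 : x0 + w != 0.
  apply/eqP => /eqP; rewrite addr_eq0 => /eqP x0w.
  by move: w2; rewrite x0w normrN ltxx.
have [rhoy|yrho] := leP rho `|x0 + w|.
  by apply: xmin; apply/mem_set; rewrite /= rhoy yr.
by apply: le_trans x01 _; apply: small => //; exact: ltW.
Qed.
End comparison_with_barrier.

(** * Comparison of the two norms, Taylor expansion, and the minimum principle *)

Section conclusion.
Variables (R : realType) (n : nat).
Implicit Types (x : 'rV[R]_n).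

Lemma ler_norm_enorm x : `|x| <= enorm x.
Proof.
apply: norm_mx_le => [|i j]; first exact: sqrtr_ge0.
rewrite ord1 -sqrtr_sqr ler_sqrt ?dot_ge0// /dot (bigD1 j)//= -expr2 lerDl.
by apply: sumr_ge0 => k _; rewrite -expr2 sqr_ge0.
Qed.

Lemma enorm_ler_norm x : (0 < n)%N -> enorm x <= n%:R * `|x|.
Proof.
move=> n0; have nx0 : 0 <= n%:R * `|x| by rewrite mulr_ge0.
rewrite -[leRHS]ger0_norm// -sqrtr_sqr ler_sqrt ?sqr_ge0//.
apply: le_trans (le_trans (ler_norm _) (dot_le x x)) _.
by rewrite exprMn expr2 -mulrA ler_peMl ?mulr_ge0// ?ler1n.
Qed.

(** The sign vector, of sup norm at most 1, turns the dot product into the l^1 norm. *)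
Lemma ler_norm_dot_sg x : `|x| <= dot (\row_i Num.sg (x 0 i)) x.
Proof.
rewrite /dot (eq_bigr (fun i => `|x 0 i|)); last first.
  by move=> i _; rewrite mxE normrEsg.
apply: norm_mx_le => [|i j]; first by apply: sumr_ge0.
by rewrite ord1 (bigD1 j)//= lerDl sumr_ge0.
Qed.

(** The origin is interior to the Euclidean ball, and the closed sup-norm ball contains its
    closure. *)
Lemma boundary_eball (r : R) x : (0 < n)%N -> 0 < r ->
  boundary (@eball R n r) x -> x != 0 /\ `|x| <= r.
Proof.
move=> n0 r0 [clx nix]; split.
  apply/eqP => x0; apply: nix; rewrite x0.
  apply/nbhs_ballP; exists (r / n%:R); first by rewrite /= divr_gt0// ltr0n.
  move=> y; rewrite -ball_normE/= sub0r normrN ltr_pdivlMr ?ltr0n// => yr.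
  by apply: le_lt_trans (enorm_ler_norm y n0) _; rewrite mulrC.
have cl : closed [set y : 'rV[R]_n | `|y| <= r].
  have -> : [set y : 'rV[R]_n | `|y| <= r] = Num.norm @^-1` [set y | y <= r] by [].
  apply: preimage_closed; last exact: closed_le.
  by move=> y _; exact: norm_continuous.
have sub : eball r `<=` [set y : 'rV[R]_n | `|y| <= r].
  by move=> y /= yr; rewrite (le_trans (ler_norm_enorm y))// ltW.
by have := closure_subset sub clx; rewrite -(closure_id _).1.
Qed.

Lemma first_order_expansion (D : set 'rV[R]_n) (v : 'rV[R]_n -> R) e :
  open D -> C2 D v -> D 0 -> 0 < e ->
  exists2 r, 0 < r & forall x, `|x| < r ->
    `|v x - v 0 - dot (grad v 0) x| <= e * `|x|.
Proof.
move=> oD v2 D0 e0.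
have k0 : 0 < n%:R + 1 :> R by rewrite ltr_wpDl.
(* Compensates the factor [n] that [dot_le] costs in the sup norm. *)
have e'0 : 0 < e / (n%:R + 1) by rewrite divr_gt0.
have [r r0 H] := jet_at_near oD v2 D0 e'0.
exists r => // x xr.
have sx s : 0 <= s <= 1 -> `|s *: x - 0| < r.
  move=> /andP[s0 s1]; rewrite subr0 normrZ ger0_norm//.
  by apply: le_lt_trans xr; rewrite -[leRHS]mul1r ler_wpM2r.
have [|s /andP[s0 s1]] := MVT_line (f := v) (df := 'D_x v) (z := 0) (a := x) (t := 1).
  move=> s s01; rewrite add0r mulr1; have [Ds _] := H _ (sx _ s01).
  exact: is_derive_C1 v2.1 I Ds.
rewrite scale1r mulr1 !add0r mul1r => ->.
have s01 : 0 <= s <= 1 by rewrite (ltW s0).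
have [Ds js] := H _ (sx _ s01).
rewrite (derive_grad _ oD v2.1 Ds).
have -> : dot (grad v (s *: x)) x - dot (grad v 0) x =
    dot (grad v (s *: x) - grad v 0) x.
  by rewrite dotDl -(scaleN1r (grad v 0)) dotZl mulN1r.
apply: le_trans (dot_le _ _) _; rewrite mulrA ler_wpM2r//.
have [_ _ + _] := norm_jet (jet_at v (s *: x) - jet_at v 0).
move=> /le_trans/(_ js) /= gs.
apply: (le_trans (ler_wpM2l (ler0n R n) gs)).
by rewrite mulrCA -[leRHS]mulr1 ler_wpM2l ?(ltW e0)// ler_pdivrMr// mul1r lerDl.
Qed.

Lemma limf_einf_gt0 (f : 'rV[R]_n -> R) e r : 0 < e -> 0 < r ->
  (forall x, x != 0 -> `|x| < r -> e <= f x) ->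
  (0 < limf_einf (fun x => (f x)%:E) (0%R : 'rV[R]_n)^')%E.
Proof.
move=> e0 r0 fe; rewrite limf_einfE.
apply: (@lt_le_trans _ _ e%:E); first by rewrite lte_fin.
pose V := [set x : 'rV[R]_n | x != 0 /\ `|x| < r].
apply: (@le_trans _ _ (ereal_inf [set (f x)%:E | x in V])).
  by apply: le_ereal_inf_tmp => _ [x [x0 xr] <-]; rewrite lee_fin; exact: fe.
apply: ereal_sup_ubound; exists V => //.
apply/nbhs_ballP; exists r => // x; rewrite -ball_normE/= sub0r normrN => xr x0.
by split.
Qed.

End conclusion.

Theorem theorem1p1 (R : realType) (n : nat) (n_ge1 : (1 <= n)%N)
    (Omega : set 'rV[R]_n) (dom_Omega : is_domain Omega) (Omega0 : Omega 0)
    (F : jet R n -> R) (F_C1 : C1_operator Omega F)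
    (F_elliptic : forall z, jet_dom Omega z -> posdefmx (- dF_dM F z))
    (u v : 'rV[R]_n -> R)
    (u_C2 : C2 (Omega `\ 0) u) (v_C2 : C2 Omega v)
    (rbar : R) (rbar_gt0 : 0 < rbar) (ball_sub : eball rbar `<=` Omega)
    (inf_eq_min : forall (V : 'rV[R]_n) (r : R), 0 < r -> r < rbar ->
       let w := fun x => u x + dot V x in
       exists2 m : R, is_min [set w x | x in boundary (eball r)] m
                    & infimums [set w x | x in eball r `\ 0] m)
    (v_lt_u : forall x, (Omega `\ 0) x -> v x < u x)
    (F_ge : forall x, (Omega `\ 0) x ->
       F (x, u x, grad u x, hessian u x) >= F (x, v x, grad v x, hessian v x)) :
  (0 < limf_einf (fun x => (u x - v x)%:E) (0%R : 'rV[R]_n)^')%E.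
Proof.
have [openO _ _] := dom_Omega.
have [A [eps0 [r0 [A0 eps00 r00 Ar0 nomin]]]] :=
  barrier_no_minimum openO Omega0 n_ge1 F_C1 F_elliptic u_C2 v_C2 v_lt_u F_ge.
have [eps [r [eps_gt0 r_gt0 bar]]] :=
  barrier_le openO Omega0 u_C2.1.1 v_C2.1.1 v_lt_u A0 eps00 r00 Ar0 nomin.
(* Here [V] depends on [x]; the quadratic part of the barrier is nonnegative and is dropped. *)
have gap x : x != 0 -> `|x| <= r -> eps * `|x| <= u x - v x.
  move=> x0 xr; have [|_] := bar (\row_i Num.sg (x 0 i)) x _ x0 xr.
    apply: norm_mx_le => // i j; rewrite mxE normr_sg lern1; by case: (_ != _).
  apply: le_trans; rewrite ler_wpM2l ?(ltW eps_gt0)//.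
  apply: le_trans (ler_norm_dot_sg x) _.
  by rewrite /barrier lerDl mulr_ge0 ?dot_ge0 ?ltW.
(* Half of the linear gap pays for the Taylor error of [v]. *)
have e2 : 0 < eps / 2 by rewrite divr_gt0.
have [r1 r10 vexp] := first_order_expansion openO v_C2 Omega0 e2.
pose rho := Num.min (rbar / 2) (Num.min (r1 / 2) r).
have rho0 : 0 < rho by rewrite !lt_min !divr_gt0.
have half_lt (a : R) : 0 < a -> a / 2 < a.
  by move=> a0; rewrite ltr_pdivrMr// mulr_natr mulr2n ltrDl.
have rho_rbar : rho < rbar.
  by apply: le_lt_trans (half_lt _ rbar_gt0); rewrite ge_min lexx.
have rho_r1 : rho < r1.
  by apply: le_lt_trans (half_lt _ r10); rewrite !ge_min lexx orbT.
have rho_r : rho <= r by rewrite !ge_min lexx !orbT.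
have [m [[y ybd wy] _] [mlb _]] := inf_eq_min (- grad v 0) rho rho0 rho_rbar.
have [y0 yrho] := boundary_eball n_ge1 rho0 ybd.
have dotN x : dot (- grad v 0) x = - dot (grad v 0) x.
  by rewrite -(scaleN1r (grad v 0)) dotZl mulN1r.
(* The minimum is attained at [y], where the gap minus the Taylor error leaves
   [m - v 0 >= eps / 2 * |y|]. *)
have m_gt : v 0 < m.
  rewrite -wy dotN.
  have := gap _ y0 (le_trans yrho rho_r).
  have := vexp _ (le_lt_trans yrho rho_r1).
  have : 0 < eps * `|y| by rewrite mulr_gt0// normr_gt0.
  rewrite ler_norml mulrAC => + /andP[+ _].
  move: (eps * `|y|) (u y) (v y) (v 0) (dot _ _) => a b c d e.
  by lra.
have eta0 : 0 < (m - v 0) / 2 by rewrite divr_gt0// subr_gt0.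
(* The three bounds place [x] in the Euclidean ball of radius [rho], make the expansion valid, and
   keep its error [eps / 2 * |x|] below half of [m - v 0]. *)
pose r3 := Num.min (rho / n%:R) (Num.min r1 ((m - v 0) / eps)).
have n0 : 0 < n%:R :> R by rewrite ltr0n.
have r30 : 0 < r3 by rewrite !lt_min r10 !divr_gt0// subr_gt0.
apply: limf_einf_gt0 eta0 r30 _ => x x0; rewrite !lt_min => /and3P[x1 x2 x3].
have xm : m <= u x + dot (- grad v 0) x.
  apply: mlb; exists x => //; split; last exact/eqP.
  apply: le_lt_trans (enorm_ler_norm x n_ge1) _.
  by move: x1; rewrite ltr_pdivlMr// mulrC.
have := vexp _ x2; rewrite ler_norml mulrAC => /andP[_].
move: xm x3; rewrite dotN ltr_pdivlMr// mulrC.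
move: (eps * `|x|) (u x) (v x) (v 0) (dot _ _) => a b c d e.
by lra.
Qed.
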